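(* Let $A=(a_{ij})\in\mathbb{R}^{n\times n}$ be an H-matrix (the crisp coefficient matrix of a fuzzy system of linear equations $Ax=b$), and let $S\in\mathbb{R}^{2n\times 2n}$ be the associated matrix $S=\begin{pmatrix} S_1 & S_2\\ S_2 & S_1\end{pmatrix}$, where $S_1=(\alpha_{ij})\in\mathbb{R}^{n\times n}$ has entries $\alpha_{ij}=a_{ij}$ if $a_{ij}>0$ and $\alpha_{ij}=0$ otherwise, and $S_2=A-S_1$. Then there exists a permutation matrix $P\in\mathbb{R}^{2n\times 2n}$ such that $PS$ is also an H-matrix.
   Context: A real vector or matrix is called nonnegative ($\geq 0$) if all its entries are nonnegative. A square real matrix $B=(b_{ij})\in\mathbb{R}^{k\times k}$ is an M-matrix if $b_{ii}>0$ for all $i$, $b_{ij}\le 0$ for all $i\neq j$, $B$ is nonsingular, and $B^{-1}\ge 0$ entrywise. The comparison matrix $\mathcal{M}(B)=(m_{ij})$ is defined by $m_{ii}=|b_{ii}|$ and $m_{ij}=-|b_{ij}|$ for $i\ne j$. The matrix $B$ is an H-matrix if $\mathcal{M}(B)$ is an M-matrix. A permutation matrix is a square matrix with exactly one $1$ in each row and each column and $0$s elsewhere. *)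

(* Defs.v *)
(* Library: Mathematical Components, with MathComp-Analysis's realType. *)
From HB Require Import structures.
From mathcomp Require Import all_boot all_order all_algebra.
From mathcomp Require Import reals.

Set Implicit Arguments.
Unset Strict Implicit.
Unset Printing Implicit Defensive.

Import Order.TTheory GRing.Theory Num.Theory.
Local Open Scope ring_scope.

Definition nonneg_mx (R : realFieldType) (m n : nat) (B : 'M[R]_(m, n)) : Prop :=
  forall i j, 0 <= B i j.

Definition M_matrix (R : realFieldType) (k : nat) (B : 'M[R]_k) : Prop :=
  [/\ forall i, 0 < B i i,
      forall i j, i != j -> B i j <= 0,
      B \in unitmx
    & nonneg_mx (invmx B)].

Definition comparison_mx (R : realFieldType) (k : nat) (B : 'M[R]_k) : 'M[R]_k :=
  \matrix_(i, j) (if i == j then `|B i j| else - `|B i j|).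

Definition H_matrix (R : realFieldType) (k : nat) (B : 'M[R]_k) : Prop :=
  M_matrix (comparison_mx B).

Definition S1 (R : realFieldType) (n : nat) (A : 'M[R]_n) : 'M[R]_n :=
  \matrix_(i, j) (if 0 < A i j then A i j else 0).

Definition S2 (R : realFieldType) (n : nat) (A : 'M[R]_n) : 'M[R]_n := A - S1 A.

Definition assoc_mx (R : realFieldType) (n : nat) (A : 'M[R]_n) : 'M[R]_(n + n) :=
  block_mx (S1 A) (S2 A) (S2 A) (S1 A).

(* Main.v *)
Require Import Defs.
From HB Require Import structures.
From mathcomp Require Import all_boot all_order all_algebra.
From mathcomp Require Import perm reals.

(** The matrix [PS] is obtained by exchanging, for each [i] with [a_ii < 0],
    the two rows of [S] that come from row [i] of [A].  After the exchange the
    two diagonal entries coming from [a_ii] are [a_ii] itself, and the other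
    two copies of position [(i, i)] hold [0].  Since [S1] and [S2] have
    disjoint supports, [|S1 i j| + |S2 i j| = |a_ij|]; hence in either of the
    two rows of the comparison matrix [M(PS)] that come from row [i] of [A],
    the entries in the two columns that come from column [j] add up to the
    entry [(i, j)] of [M(A)] ([comparison_assoc_pair]).  So [M(PS)] maps
    [(v, v)] to [(M(A) v, M(A) v)] for every vector [v].

    It remains to use the classical characterisation of M-matrices by
    semipositivity: a matrix [B] with nonpositive off-diagonal entries is an
    M-matrix exactly when [B v > 0] for some [v > 0]
    ([M_matrix_semipositive], [semipositive_M_matrix]).  A vector [v] for
    [M(A)] yields the vector [(v, v)] for [M(PS)]. *)

Set Implicit Arguments.
Unset Strict Implicit.
Unset Printing Implicit Defensive.

Import Order.TTheory GRing.Theory Num.Theory.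
Local Open Scope ring_scope.

Definition positive_cV (R : realFieldType) (k : nat) (v : 'cV[R]_k) : Prop :=
  forall i, 0 < v i 0.

(** The vector is [v = B^-1 1].  It is nonnegative because [B^-1] is, and
    then [B v = 1] forces [b_ii v_i >= 1], as the off-diagonal terms of
    row [i] contribute nonpositively. *)
Lemma M_matrix_semipositive (R : realFieldType) (k : nat) (B : 'M[R]_k) :
  M_matrix B -> exists2 v : 'cV[R]_k, positive_cV v & positive_cV (B *m v).
Proof.
case=> Bd Bo Bu Bi.
pose v : 'cV[R]_k := invmx B *m const_mx 1.
have Bv : B *m v = const_mx 1 by rewrite mulmxA mulmxV // mul1mx.
have v_ge0 i : 0 <= v i 0.
  by rewrite mxE sumr_ge0 // => j _; rewrite mxE mulr1; apply: Bi.
clearbody v; exists v => i; last by rewrite Bv mxE ltr01.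
rewrite -(pmulr_rgt0 _ (Bd i)).
have := congr1 (fun u : 'cV_k => u i 0) Bv.
rewrite !mxE (bigD1 i) //= => /(canRL (addrK _)) ->.
rewrite subr_gt0 (@le_lt_trans _ _ 0) ?ltr01 //.
by apply: sumr_le0 => j ji; rewrite mulr_le0_ge0 ?Bo // eq_sym.
Qed.

(** A minimum principle: at an index [i] minimising [x_i / v_i = t], the sign
    pattern of [B] gives [(B x)_i <= t (B v)_i], so [t < 0] would contradict
    [B x >= 0]. *)
Lemma semipositive_monotone (R : realFieldType) (k : nat) (B : 'M[R]_k)
    (v x : 'cV[R]_k) :
  (forall i j, i != j -> B i j <= 0) -> positive_cV v ->
  positive_cV (B *m v) -> nonneg_mx (B *m x) -> nonneg_mx x.
Proof.
move=> Bo v_gt0 Bv_gt0 Bx_ge0 i0 j0; rewrite ord1 leNgt; apply/negP => xi0.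
have [i _ imin] :=
  @arg_minP _ _ _ i0 xpredT (fun i => x i 0 / v i 0) isT.
set t := x i 0 / v i 0 in imin.
have t_lt0 : t < 0.
  by rewrite (le_lt_trans (imin i0 isT)) // pmulr_llt0 // invr_gt0.
have : (B *m x) i 0 <= t * (B *m v) i 0.
  rewrite !mxE mulr_sumr ler_sum // => j _; rewrite mulrCA.
  have [<-|ij] := eqVneq i j; first by rewrite divfK // gt_eqF.
  by rewrite ler_wnM2l ?Bo // -ler_pdivlMr // imin.
by apply/negP; rewrite -ltNge (lt_le_trans _ (Bx_ge0 i 0)) // nmulr_rlt0.
Qed.

(** Everything follows from monotonicity: applied to [x] and [- x] it makes the
    kernel of [B] trivial, and applied to the columns of [B^-1] it makes them
    nonnegative. *)
Lemma semipositive_M_matrix (R : realFieldType) (k : nat) (B : 'M[R]_k)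
    (v : 'cV[R]_k) :
  (forall i j, i != j -> B i j <= 0) -> positive_cV v ->
  positive_cV (B *m v) -> M_matrix B.
Proof.
move=> Bo v_gt0 Bv_gt0.
have mono x := @semipositive_monotone _ _ _ _ x Bo v_gt0 Bv_gt0.
have Bu : B \in unitmx.
  rewrite -unitmx_tr -row_free_unit -kermx_eq0; apply/rowV0P => u /sub_kermxP uB.
  have Bu0 : B *m u^T = 0 by rewrite -[B]trmxK -trmx_mul uB trmx0.
  have u_ge0 : nonneg_mx u^T by apply: mono => i j; rewrite Bu0 mxE.
  have u_le0 : nonneg_mx (- u^T).
    by apply: mono => i j; rewrite mulmxN Bu0 oppr0 mxE.
  apply/rowP => j; apply/eqP; rewrite mxE eq_le.
  have := u_ge0 j 0; have := u_le0 j 0.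
  by rewrite !mxE oppr_ge0 => -> ->.
split=> // [i|i j].
  rewrite -(pmulr_lgt0 _ (v_gt0 i)) (lt_le_trans (Bv_gt0 i)) //.
  rewrite mxE (bigD1 i) //= gerDl sumr_le0 // => j ji.
  by rewrite mulr_le0_ge0 ?Bo 1?eq_sym // ltW.
have : nonneg_mx (col j (invmx B)).
  by apply: mono => a b; rewrite colE mulmxA mulmxV // mul1mx mxE ler0n.
by move=> /(_ i 0); rewrite mxE.
Qed.

Section RowExchange.

Variables (R : realFieldType) (n : nat) (A : 'M[R]_n).

Definition exchange_fun (k : 'I_(n + n)) : 'I_(n + n) :=
  match split k with
  | inl i => if A i i < 0 then rshift n i else lshift n i
  | inr i => if A i i < 0 then lshift n i else rshift n i
  end.

Lemma exchange_lshift i :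
  exchange_fun (lshift n i) = if A i i < 0 then rshift n i else lshift n i.
Proof. by rewrite /exchange_fun (unsplitK (inl i)). Qed.

Lemma exchange_rshift i :
  exchange_fun (rshift n i) = if A i i < 0 then lshift n i else rshift n i.
Proof. by rewrite /exchange_fun (unsplitK (inr i)). Qed.

Lemma exchange_funK : involutive exchange_fun.
Proof.
move=> k; rewrite -[k]splitK; case: (split k) => i /=.
  rewrite exchange_lshift; case: ifP => Ai.
    by rewrite exchange_rshift Ai.
  by rewrite exchange_lshift Ai.
rewrite exchange_rshift; case: ifP => Ai.
  by rewrite exchange_lshift Ai.
by rewrite exchange_rshift Ai.
Qed.

Definition exchange_perm : {perm 'I_(n + n)} := perm (inv_inj exchange_funK).

Lemma S1E i j : S1 A i j = if 0 < A i j then A i j else 0.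
Proof. by rewrite mxE. Qed.

Lemma S2E i j : S2 A i j = if 0 < A i j then 0 else A i j.
Proof. by rewrite !mxE; case: ifP; rewrite ?subrr ?subr0. Qed.

Lemma normS1D i j : `|S1 A i j| + `|S2 A i j| = `|A i j|.
Proof. by rewrite S1E S2E; case: ifP; rewrite normr0 ?addr0 ?add0r. Qed.

Let C := comparison_mx (perm_mx exchange_perm *m assoc_mx A).

Lemma comparison_exchangeE k l :
  C k l = if k == l then `|assoc_mx A (exchange_fun k) l|
          else - `|assoc_mx A (exchange_fun k) l|.
Proof. by rewrite mxE -row_permE mxE permE. Qed.

(** Off the diagonal this is [normS1D].  On the diagonal the exchange has put
    the copy of [a_ii] at position [(k, k)], where the comparison matrix
    gives it a positive sign, and its companion entry vanishes. *)
Lemma comparison_assoc_pair i j (k : 'I_(n + n)) :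
  k = lshift n i \/ k = rshift n i ->
  C k (lshift n j) + C k (rshift n j) = comparison_mx A i j.
Proof.
case=> ->; rewrite [RHS]mxE !comparison_exchangeE
  ?exchange_lshift ?exchange_rshift.
  rewrite eq_lshift eq_lrshift /assoc_mx.
  case: (ltrP (A i i) 0) => Ai; rewrite ?block_mxEdl ?block_mxEdr ?block_mxEul ?block_mxEur.
  - have [<-|ij] := eqVneq i j; last by rewrite -opprD addrC normS1D.
    by rewrite S1E S2E ltNge ltW //= normr0 subr0.
  - have [<-|ij] := eqVneq i j; last by rewrite -opprD normS1D.
    rewrite S1E S2E lt_neqAle Ai andbT eq_sym.
    by case: eqVneq => [->|_] /=; rewrite ?normr0 ?subr0.
rewrite eq_rshift eq_rlshift /assoc_mx.
case: (ltrP (A i i) 0) => Ai; rewrite ?block_mxEdl ?block_mxEdr ?block_mxEul ?block_mxEur.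
- have [<-|ij] := eqVneq i j; last by rewrite -opprD normS1D.
  by rewrite S1E S2E ltNge ltW //= normr0 oppr0 add0r.
- have [<-|ij] := eqVneq i j; last by rewrite -opprD addrC normS1D.
  rewrite S1E S2E lt_neqAle Ai andbT eq_sym.
  by case: eqVneq => [->|_] /=; rewrite ?normr0 ?oppr0 ?add0r.
Qed.

Lemma comparison_assoc_mul_pair (v : 'cV[R]_n) :
  C *m col_mx v v = col_mx (comparison_mx A *m v) (comparison_mx A *m v).
Proof.
have CvE i k : k = lshift n i \/ k = rshift n i ->
    (C *m col_mx v v) k 0 = (comparison_mx A *m v) i 0.
  move=> ki; rewrite mxE [RHS]mxE big_split_ord /= -big_split /=.
  apply: eq_bigr => j _.
  by rewrite col_mxEu col_mxEd -mulrDl (comparison_assoc_pair _ ki).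
apply/colP => k; rewrite -[k]splitK; case: (split k) => i /=.
  by rewrite col_mxEu (CvE i) //; left.
by rewrite col_mxEd (CvE i) //; right.
Qed.

End RowExchange.

Lemma comparison_mx_offdiag (R : realFieldType) (k : nat) (B : 'M[R]_k) i j :
  i != j -> comparison_mx B i j <= 0.
Proof. by move=> /negPf ij; rewrite mxE ij oppr_le0. Qed.

Lemma positive_col_mx (R : realFieldType) (m n : nat) (u : 'cV[R]_m)
    (v : 'cV[R]_n) :
  positive_cV u -> positive_cV v -> positive_cV (col_mx u v).
Proof.
move=> u_gt0 v_gt0 k; rewrite -[k]splitK.
by case: (split k) => i /=; rewrite ?col_mxEu ?col_mxEd.
Qed.

Theorem theorem4 (R : realType) (n : nat) (A : 'M[R]_n) :
  H_matrix A ->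
  exists P : 'M[R]_(n + n), is_perm_mx P /\ H_matrix (P *m assoc_mx A).
Proof.
move=> /M_matrix_semipositive[v v_gt0 Av_gt0].
exists (perm_mx (exchange_perm A)); split; first exact: perm_mx_is_perm.
apply: (@semipositive_M_matrix _ _ _ (col_mx v v)).
- exact: comparison_mx_offdiag.
- exact: positive_col_mx.
- by rewrite comparison_assoc_mul_pair; apply: positive_col_mx.
Qed.
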